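(* Let $G$ be a connected graph with at least two vertices and let $k$ be a positive integer. Then $G$ is $k$-partition dimensional if and only if $G$ is $k$-metric dimensional.
   Context: All graphs $G=(V,E)$ are finite, simple, connected and have at least two vertices; $d(x,y)$ is the shortest-path distance in $G$. Metric notions: a vertex $v\in V$ distinguishes two different vertices $x,y$ if $d(v,x)\neq d(v,y)$. A set $S\subseteq V$ is a $k$-metric generator of $G$ if every pair of different vertices of $G$ is distinguished by at least $k$ elements of $S$. A $k$-metric basis is a $k$-metric generator of minimum cardinality. $G$ is $k$-metric dimensional if $k$ is the largest integer such that there exists a $k$-metric basis of $G$. Partition notions: for $a\in V$ and nonempty $S\subseteq V$, $d(a,S)=\min_{v\in S}d(a,v)$; $S$ distinguishes different vertices $x,y$ if $d(x,S)\neq d(y,S)$. A partition $\Pi$ of $V$ (into nonempty sets) is a $k$-partition generator of $G$ if every pair of different vertices of $G$ is distinguished by at least $k$ of the sets of $\Pi$. A $k$-partition basis is a $k$-partition generator of minimum cardinality. $G$ is $k$-partition dimensional if $k$ is the largest integer such that there exists a $k$-partition basis of $G$. *)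

(* Defs.v *)
From mathcomp Require Import all_boot.

Set Implicit Arguments.
Unset Strict Implicit.
Unset Printing Implicit Defensive.

(* A graph on the vertex type T is given by its adjacency relation e : rel T;
   simplicity is symmetric e and irreflexive e. *)

Section Metric.

Variables (T : finType) (e : rel T).

Definition connected_graph : Prop := forall x y : T, connect e x y.

Definition has_path (n : nat) (x y : T) : bool :=
  [exists p : n.-tuple T, [&& path e x p, uniq (x :: p) & last x p == y]].

(* The least length of a path from x to y. Paths have length < #|T|, so #|T|
   is returned exactly when y is not reachable from x. *)
Definition dist (x y : T) : nat := find (fun n => has_path n x y) (iota 0 #|T|).

(* All distances are at most #|T|, so #|T| is neutral for minn here and the
   value is the minimum over S whenever S is nonempty. *)
Definition set_dist (a : T) (S : {set T}) : nat :=
  \big[minn/#|T|]_(v in S) dist a v.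

Definition distinguishes (v x y : T) : bool := dist v x != dist v y.

Definition set_distinguishes (S : {set T}) (x y : T) : bool :=
  set_dist x S != set_dist y S.

Definition metric_generator (k : nat) (S : {set T}) : Prop :=
  forall x y : T, x != y -> k <= #|[set v in S | distinguishes v x y]|.

Definition metric_basis (k : nat) (S : {set T}) : Prop :=
  metric_generator k S /\
  forall S' : {set T}, metric_generator k S' -> #|S| <= #|S'|.

Definition metric_dimensional (k : nat) : Prop :=
  (exists S : {set T}, metric_basis k S) /\
  forall k' : nat, (exists S : {set T}, metric_basis k' S) -> k' <= k.

Definition partition_generator (k : nat) (P : {set {set T}}) : Prop :=
  partition P [set: T] /\
  forall x y : T, x != y -> k <= #|[set S in P | set_distinguishes S x y]|.

Definition partition_basis (k : nat) (P : {set {set T}}) : Prop :=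
  partition_generator k P /\
  forall P' : {set {set T}}, partition_generator k P' -> #|P| <= #|P'|.

Definition partition_dimensional (k : nat) : Prop :=
  (exists P : {set {set T}}, partition_basis k P) /\
  forall k' : nat, (exists P : {set {set T}}, partition_basis k' P) -> k' <= k.

End Metric.

(* Main.v *)
(** Both generator properties are extreme at the finest choice: [V] is a
    k-metric generator, respectively the partition into singletons is a
    k-partition generator, as soon as any is. A singleton distinguishes the same
    pairs as its element; conversely a set distinguishing [x] and [y] contains a
    vertex distinguishing them, and the blocks of a partition are disjoint. So
    k-metric and k-partition generators, hence bases, exist for the same [k]. *)
Require Import Defs.
From mathcomp Require Import all_boot.

Set Implicit Arguments.
Unset Strict Implicit.
Unset Printing Implicit Defensive.

Section Generators.

Variables (T : finType) (e : rel T).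
Implicit Types (x y v : T) (S : {set T}) (P : {set {set T}}) (k : nat).

Lemma has_path_sym : symmetric e -> forall n x y,
  has_path e n x y -> has_path e n y x.
Proof.
move=> e_sym n x y /existsP[p /and3P[e_p Up /eqP def_y]].
(* The reversed walk is [rev (x :: p)]; its head [last x p] is the new starting vertex, so only
   [rev (belast x p)] goes into the tuple. *)
have sz : size (rev (belast x p)) == n.
  by rewrite size_rev size_belast size_tuple.
apply/existsP; exists (Tuple sz) => /=; rewrite -def_y rev_path.
have rev_p : last x p :: rev (belast x p) = rev (x :: p).
  by rewrite -rev_rcons -lastI.
rewrite -cons_uniq rev_p rev_uniq Up.
rewrite (eq_path (e' := e)) => [|? ?]; last exact: e_sym.
by rewrite e_p /=; case: (tval p) => //= a s; rewrite rev_cons last_rcons.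
Qed.

Lemma dist_sym : symmetric e -> forall x y, dist e x y = dist e y x.
Proof.
by move=> e_sym x y; apply: eq_find => n; apply/idP/idP; apply: has_path_sym.
Qed.

(** Makes the starting value [#|T|] of the minimum in [set_dist] harmless on singletons. *)
Lemma dist_le_card x y : dist e x y <= #|T|.
Proof. by rewrite -[leqRHS](size_iota 0); apply: find_size. Qed.

Lemma set_dist1 x v : set_dist e x [set v] = dist e x v.
Proof. by rewrite /set_dist big_set1E; apply/minn_idPl/dist_le_card. Qed.

Lemma set_distinguishes1 : symmetric e -> forall v x y,
  set_distinguishes e [set v] x y = distinguishes e v x y.
Proof.
move=> e_sym v x y; rewrite /set_distinguishes !set_dist1.
by rewrite /distinguishes !(dist_sym e_sym v).
Qed.

(** Otherwise both minima would range over equal terms; symmetry reconciles [dist x v] with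
    [dist v x]. *)
Lemma set_distinguishes_mem : symmetric e -> forall S x y,
  set_distinguishes e S x y -> exists2 v, v \in S & distinguishes e v x y.
Proof.
move=> e_sym S x y dS; apply/exists_inP; apply: contraNT dS => /exists_inPn nS.
apply/eqP/eq_bigr => v /nS; rewrite negbK => /eqP dv.
by rewrite dist_sym // dv dist_sym.
Qed.

Lemma metric_generator_setT k S :
  metric_generator e k S -> metric_generator e k [set: T].
Proof.
move=> genS x y /genS/leq_trans; apply; apply/subset_leq_card/subsetP => v.
by rewrite !inE => /andP[].
Qed.

(** By finiteness, a generator of least cardinality exists as soon as any generator does. *)
Lemma metric_basis_exists k :
  (exists S, metric_basis e k S) <-> metric_generator e k [set: T].
Proof.
split=> [[S [/metric_generator_setT]] //|genT].
pose gen S := [forall x, forall y,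
  (x != y) ==> (k <= #|[set v in S | distinguishes e v x y]|)].
have genP S : reflect (metric_generator e k S) (gen S).
  apply: (iffP 'forall_'forall_implyP) => g x y; exact: g.
have [S /genP genS minS] := arg_minnP (fun S => #|S|) (introT (genP _) genT).
by exists S; split=> // S' /genP; apply: minS.
Qed.

Lemma partition_generator_metric k P : symmetric e ->
  partition_generator e k P -> metric_generator e k [set: T].
Proof.
move=> e_sym [/and3P[_ tiP _] genP] x y /genP/leq_trans; apply.
set D := [set v in setT | _].
(* The image of [D] under [pblock P] contains every distinguishing block, so there are at most
   [#|D|] of them. *)
apply: leq_trans (leq_imset_card (pblock P) D).
apply/subset_leq_card/subsetP => S; rewrite inE => /andP[PS].
case/(set_distinguishes_mem e_sym) => v Sv dv.
by apply/imsetP; exists v; rewrite ?(def_pblock tiP PS Sv) // !inE.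
Qed.

Lemma partition_set1 : partition [set [set x] | x : T] [set: T].
Proof.
apply/and3P; split.
- rewrite eqEsubset subsetT; apply/subsetP => x _.
  by apply/bigcupP; exists [set x]; rewrite ?imset_f ?set11.
- apply/trivIsetP => _ _ /imsetP[x _ ->] /imsetP[y _ ->] nxy.
  by rewrite disjoints1 inE; apply: contraNneq nxy => ->.
- by apply/imsetP => -[x _ /setP/(_ x)]; rewrite !inE eqxx.
Qed.

Lemma partition_generator_set1 k : symmetric e ->
  metric_generator e k [set: T] ->
  partition_generator e k [set [set x] | x : T].
Proof.
move=> e_sym genT; split=> [|x y /genT/leq_trans]; first exact: partition_set1.
apply; rewrite -(card_imset _ (@set1_inj T)).
(* The injection of [v] to [[set v]] sends distinguishing vertices to distinguishing blocks. *)
apply/subset_leq_card/subsetP => _ /imsetP[v + ->].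
by rewrite !inE imset_f //= set_distinguishes1.
Qed.

Lemma partition_basis_exists k : symmetric e ->
  (exists P, partition_basis e k P) <-> metric_generator e k [set: T].
Proof.
move=> e_sym; split=> [[P [genP _]]|].
  exact: partition_generator_metric genP.
move/(partition_generator_set1 e_sym) => gen1.
pose gen P := partition P [set: T] && [forall x, forall y,
  (x != y) ==> (k <= #|[set S in P | set_distinguishes e S x y]|)].
have genP P : reflect (partition_generator e k P) (gen P).
  apply: (iffP andP) => -[partP g]; split=> //.
    by move=> x y; move/'forall_'forall_implyP: g; apply.
  by apply/'forall_'forall_implyP => x y; apply: g.
have [P /genP genP0 minP] := arg_minnP (fun P => #|P|) (introT (genP _) gen1).
by exists P; split=> // P' /genP; apply: minP.
Qed.

End Generators.

Theorem theorem6 (T : finType) (e : rel T) (e_sym : symmetric e)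
    (e_irr : irreflexive e) (e_conn : connected_graph e) (T_gt1 : 1 < #|T|)
    (k : nat) (k_gt0 : 0 < k) :
  partition_dimensional e k <-> metric_dimensional e k.
Proof.
have basisE j : (exists P, partition_basis e j P) <->
    (exists S, metric_basis e j S).
  apply: iff_trans (partition_basis_exists _ e_sym) _.
  exact: iff_sym (metric_basis_exists _ _).
(* Both sides say that [k] is the largest [j] admitting a basis, and [basisE] identifies the
   admissible [j]. *)
by split=> -[/basisE bk maxk]; split=> // j /basisE; apply: maxk.
Qed.
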